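(* Let $X=(x_i)_{i=1}^{\infty}$ be any sequence of non-negative integers. For $n\ge 1$ let $A_n(X)$ be the number of colored compositions of $n$ with coloration $X$, and let $A(X)=(A_n(X))_{n=1}^{\infty}$. Then $$A(X)=I(X),$$ where $I$ is the Invert operator and $X$ is regarded as the sequence $a=(a_n)_{n=0}^\infty$ with $a_n=x_{n+1}$. That is, if $b=(b_n)_{n=0}^\infty=I(a)$, then $A_n(X)=b_{n-1}$ for all $n\ge 1$; equivalently, as formal power series, $$\sum_{n=0}^\infty A_{n+1}(X)\,t^n=\frac{\sum_{n=0}^\infty x_{n+1}t^n}{1-t\sum_{n=0}^\infty x_{n+1}t^n}.$$
   Context: A coloration is a sequence $X=(x_i)_{i=1}^\infty$ of non-negative integers; $x_i$ is the number of available colors of a part of size $i$ (if $x_i=0$, the part $i$ is not used). A colored composition of $n\ge 1$ with coloration $X$ is a finite ordered sequence of parts, each part being a positive integer $i$ (its size) together with one of its $x_i$ colors, such that the sizes sum to $n$. $A_n(X)$ denotes the number of colored compositions of $n$ with coloration $X$. The Invert operator $I$ transforms a sequence $a=(a_n)_{n=0}^\infty$ into the sequence $b=(b_n)_{n=0}^\infty$ determined by $\sum_{n\ge 0}b_nt^n=\dfrac{\sum_{n\ge 0}a_nt^n}{1-t\sum_{n\ge 0}a_nt^n}$ (as formal power series). *)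

(* Defs.v *)
From HB Require Import structures.
From mathcomp Require Import all_boot all_order all_algebra.
From mathcomp Require boolp.

Set Implicit Arguments.
Unset Strict Implicit.
Unset Printing Implicit Defensive.

Import GRing.Theory.

(* A coloration (x_i)_{i >= 1} is a function X : nat -> nat with x_i = X i;   *)
(* the value X 0 is irrelevant, since parts are required to be positive.      *)

(* A size i together with one of its X i colors. *)
Definition colored_part (X : nat -> nat) : Type := {i : nat & 'I_(X i)}.
HB.instance Definition _ (X : nat -> nat) := Countable.on (colored_part X).

Definition part_size (X : nat -> nat) (p : colored_part X) : nat := tag p.

Definition is_colored_composition (X : nat -> nat) (n : nat)
    (s : seq (colored_part X)) : bool :=
  all (fun p => 0 < part_size p) s && (\sum_(p <- s) part_size p == n).

Record colored_composition (X : nat -> nat) (n : nat) := ColoredComposition {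
  parts :> seq (colored_part X);
  _ : is_colored_composition n parts
}.
HB.instance Definition _ (X : nat -> nat) (n : nat) :=
  [isSub for @parts X n].
HB.instance Definition _ (X : nat -> nat) (n : nat) :=
  [Countable of colored_composition X n by <:].

(* Finiteness: a composition of n has at most n parts, each of size at most n. *)
Definition parts_upto (X : nat -> nat) (n : nat) : seq (colored_part X) :=
  [seq Tagged (fun i => 'I_(X i)) c | i <- iota 0 n.+1, c <- enum 'I_(X i)].

Lemma mem_parts_upto (X : nat -> nat) (n : nat) (p : colored_part X) :
  part_size p <= n -> p \in parts_upto X n.
Proof.
case: p => i c /= le_in; apply/allpairsPdep.
by exists i, c; rewrite mem_iota add0n ltnS le_in mem_enum.
Qed.

Fixpoint seqs_upto (T : Type) (l : seq T) (k : nat) : seq (seq T) :=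
  if k is k'.+1 then [::] :: [seq x :: s | x <- l, s <- seqs_upto l k']
  else [:: [::]].

Lemma mem_seqs_upto (T : eqType) (l : seq T) (k : nat) (s : seq T) :
  size s <= k -> {subset s <= l} -> s \in seqs_upto l k.
Proof.
elim: k s => [|k IHk] [|x s] //= le_sk sub_sl; rewrite inE /=.
apply/allpairsP; exists (x, s); split=> //=; first exact/sub_sl/mem_head.
by apply: IHk => // y ys; apply: sub_sl; rewrite inE ys orbT.
Qed.

Lemma colored_composition_bounds (X : nat -> nat) (n : nat)
    (s : seq (colored_part X)) :
  is_colored_composition n s ->
  size s <= n /\ {in s, forall p, part_size p <= n}.
Proof.
case/andP=> pos_s /eqP <-; split; last first.
  by move=> p ps; rewrite (big_rem p ps) leq_addr.
elim: s pos_s => [|p s IHs] //= /andP[p_gt0 /IHs le_s].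
by rewrite big_cons -add1n leq_add.
Qed.

Definition colored_composition_enum (X : nat -> nat) (n : nat) :
    seq (colored_composition X n) :=
  undup (pmap insub (seqs_upto (parts_upto X n) n)).

Lemma colored_composition_enumP (X : nat -> nat) (n : nat) :
  Finite.axiom (colored_composition_enum X n).
Proof.
move=> u; rewrite count_uniq_mem ?undup_uniq // mem_undup mem_pmap_sub.
have [le_un le_parts] := colored_composition_bounds (valP u).
by rewrite mem_seqs_upto // => p /le_parts; apply: mem_parts_upto.
Qed.

HB.instance Definition _ (X : nat -> nat) (n : nat) :=
  isFinite.Build (colored_composition X n) (@colored_composition_enumP X n).

Definition num_colored_compositions (X : nat -> nat) (n : nat) : nat :=
  #|{: colored_composition X n}|.

Local Open Scope ring_scope.

(* The ring R[[t]] of formal power series. The unit series are those with a   *)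
(* unit constant coefficient, so that F / G is the quotient of formal power   *)
(* series whenever G has one (see fps_unitE).                                 *)
Record fps (R : Type) := Fps { fps_coef : nat -> R }.
HB.instance Definition _ (R : Type) := boolp.gen_eqMixin (fps R).
HB.instance Definition _ (R : Type) := boolp.gen_choiceMixin (fps R).

Lemma fpsP (R : Type) (f g : fps R) : fps_coef f =1 fps_coef g <-> f = g.
Proof.
split=> [|-> //]; case: f g => [f] [g] /= eq_fg.
by congr Fps; apply: boolp.funext.
Qed.

Definition fps_zero (R : zmodType) : fps R := Fps (fun _ => 0).
Definition fps_opp (R : zmodType) (f : fps R) : fps R :=
  Fps (fun n => - fps_coef f n).
Definition fps_add (R : zmodType) (f g : fps R) : fps R :=
  Fps (fun n => fps_coef f n + fps_coef g n).

Lemma fps_addA (R : zmodType) : associative (@fps_add R).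
Proof. by move=> f g h; apply/fpsP => n /=; rewrite addrA. Qed.
Lemma fps_addC (R : zmodType) : commutative (@fps_add R).
Proof. by move=> f g; apply/fpsP => n /=; rewrite addrC. Qed.
Lemma fps_add0 (R : zmodType) : left_id (fps_zero R) (@fps_add R).
Proof. by move=> f; apply/fpsP => n /=; rewrite add0r. Qed.
Lemma fps_addN (R : zmodType) :
  left_inverse (fps_zero R) (@fps_opp R) (@fps_add R).
Proof. by move=> f; apply/fpsP => n /=; rewrite addNr. Qed.

HB.instance Definition _ (R : zmodType) :=
  GRing.isZmodule.Build (fps R)
    (@fps_addA R) (@fps_addC R) (@fps_add0 R) (@fps_addN R).

Definition fps_one (R : comNzRingType) : fps R := Fps (fun n => (n == 0%N)%:R).
Definition fps_mul (R : comNzRingType) (f g : fps R) : fps R :=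
  Fps (fun n => \sum_(i < n.+1) fps_coef f i * fps_coef g (n - i)%N).

Definition fps_trunc (R : comNzRingType) (n : nat) (f : fps R) : {poly R} :=
  \poly_(i < n.+1) fps_coef f i.

Lemma coef_fps_trunc (R : comNzRingType) (n i : nat) (f : fps R) :
  (i <= n)%N -> (fps_trunc n f)`_i = fps_coef f i.
Proof. by move=> le_in; rewrite coef_poly ltnS le_in. Qed.

Lemma coef_fps_mul (R : comNzRingType) (n i : nat) (f g : fps R) :
  (i <= n)%N -> fps_coef (fps_mul f g) i = (fps_trunc n f * fps_trunc n g)`_i.
Proof.
move=> le_in; rewrite coefM /=; apply: eq_bigr => j _.
rewrite !coef_fps_trunc ?(leq_trans (leq_subr _ _)) //.
by rewrite (leq_trans _ le_in) // -ltnS.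
Qed.

Lemma fps_mulC (R : comNzRingType) : commutative (@fps_mul R).
Proof.
by move=> f g; apply/fpsP => n; rewrite !(coef_fps_mul _ _ (leqnn n)) mulrC.
Qed.
Lemma fps_mulA (R : comNzRingType) : associative (@fps_mul R).
Proof.
move=> f g h; apply/fpsP => n.
transitivity ((fps_trunc n f * (fps_trunc n g * fps_trunc n h))`_n).
  rewrite coefM /=; apply: eq_bigr => i _.
  rewrite coef_fps_trunc ?leq_ord //.
  by rewrite -(coef_fps_mul _ _ (leq_subr i n)).
rewrite mulrA coefM; apply/esym/eq_bigr => i _.
rewrite -(coef_fps_mul (n := n)) ?leq_ord //.
by rewrite coef_fps_trunc ?leq_subr.
Qed.
Lemma fps_mul1 (R : comNzRingType) : left_id (fps_one R) (@fps_mul R).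
Proof.
move=> f; apply/fpsP => n /=; rewrite big_ord_recl /= mul1r subn0.
by rewrite big1 ?addr0 // => i _; rewrite mul0r.
Qed.
Lemma fps_mulD (R : comNzRingType) : left_distributive (@fps_mul R) +%R.
Proof.
move=> f g h; apply/fpsP => n /=; rewrite -big_split /=.
by apply: eq_bigr => i _; rewrite mulrDl.
Qed.
Lemma fps_one_neq0 (R : comNzRingType) : fps_one R != 0.
Proof.
by apply/eqP => /fpsP/(_ 0%N) /= /eqP; rewrite oner_eq0.
Qed.

HB.instance Definition _ (R : comNzRingType) :=
  GRing.Zmodule_isComNzRing.Build (fps R) (@fps_mulA R) (@fps_mulC R)
    (@fps_mul1 R) (@fps_mulD R) (@fps_one_neq0 R).

Definition fps_unit (R : comUnitRingType) : {pred fps R} :=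
  fun f => fps_coef f 0 \is a GRing.unit.

(* The first n + 1 coefficients of the inverse of f. *)
Fixpoint fps_inv_seq (R : comUnitRingType) (f : fps R) (n : nat) : seq R :=
  if n is m.+1 then
    let s := fps_inv_seq f m in
    rcons s (- (fps_coef f 0)^-1
             * \sum_(i < m.+1) fps_coef f i.+1 * s`_(m - i))
  else [:: (fps_coef f 0)^-1].

Definition fps_inv (R : comUnitRingType) (f : fps R) : fps R :=
  if fps_unit f then Fps (fun n => (fps_inv_seq f n)`_n) else f.

Lemma size_fps_inv_seq (R : comUnitRingType) (f : fps R) (n : nat) :
  size (fps_inv_seq f n) = n.+1.
Proof. by elim: n => //= n IHn; rewrite size_rcons IHn. Qed.

Lemma nth_fps_inv_seq (R : comUnitRingType) (f : fps R) (n i : nat) :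
  (i <= n)%N -> (fps_inv_seq f n)`_i = (fps_inv_seq f i)`_i.
Proof.
elim: n => [|n IHn]; first by rewrite leqn0 => /eqP->.
rewrite leq_eqVlt ltnS => /predU1P[-> // | le_in] /=.
by rewrite nth_rcons size_fps_inv_seq ltnS le_in IHn.
Qed.

Lemma fps_mulVx (R : comUnitRingType) :
  {in @fps_unit R, left_inverse 1 (@fps_inv R) *%R}.
Proof.
move=> f Uf; rewrite mulrC /fps_inv ifT //.
apply/fpsP => -[|n] /=.
  by rewrite big_ord_recl big_ord0 addr0 mulrV.
rewrite big_ord_recl /= subn0 nth_rcons size_fps_inv_seq ltnn eqxx.
rewrite mulNr mulrN mulVKr //.
apply/eqP; rewrite addrC subr_eq0; apply/eqP/eq_bigr => i _.
by rewrite /bump /= add1n subSS (nth_fps_inv_seq _ (leq_subr i n)).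
Qed.

Lemma fps_unitPl (R : comUnitRingType) (f g : fps R) :
  g * f = 1 -> fps_unit f.
Proof.
move=> /fpsP/(_ 0%N) /=; rewrite big_ord_recl big_ord0 addr0 /= => gf1.
by apply/unitrPr; exists (fps_coef g 0); rewrite mulrC.
Qed.

Lemma fps_inv_out (R : comUnitRingType) :
  {in [predC @fps_unit R], @fps_inv R =1 id}.
Proof. by move=> f Uf; rewrite /fps_inv ifF //; apply/negbTE. Qed.

HB.instance Definition _ (R : comUnitRingType) :=
  GRing.ComNzRing_hasMulInverse.Build (fps R)
    (@fps_mulVx R) (@fps_unitPl R) (@fps_inv_out R).

Lemma fps_unitE (R : comUnitRingType) (f : fps R) :
  (f \is a GRing.unit) = (fps_coef f 0 \is a GRing.unit).
Proof. by []. Qed.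

Definition fpsX (R : comNzRingType) : fps R := Fps (fun n => (n == 1%N)%:R).

(* The denominator is always a unit (see invert_denom_unit), so this is the   *)
(* sequence b determined by \sum_n b_n t^n = a(t) / (1 - t a(t)).             *)
Definition invert (R : comUnitRingType) (a : nat -> R) : nat -> R :=
  fps_coef (Fps a / (1 - fpsX R * Fps a)).

Lemma invert_denom_unit (R : comUnitRingType) (f : fps R) :
  1 - fpsX R * f \is a GRing.unit.
Proof.
by rewrite fps_unitE /= big_ord_recl big_ord0 /= mul0r addr0 subr0 unitr1.
Qed.

(* Main.v *)
Require Import Defs.
From mathcomp Require Import all_boot all_order all_algebra.

(** Removing the first part of a nonempty colored composition, of size [i.+1]
    and one of [X i.+1] colors, leaves an arbitrary colored composition of the
    rest.  With [A_0 = 1] for the empty composition, the numbers [A_n] of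
    colored compositions therefore satisfy
    [A_(n+1) = \sum_(i <= n) x_(i+1) A_(n-i)]
    ([num_colored_compositions_rec]).  The term [i = n] is [x_(n+1) A_0]: the
    compositions with a single part.  Separating it from the others turns the
    recurrence into the identity [F = f + (t f) F] between the series
    [F = \sum_n A_(n+1) t^n] and [f = \sum_n x_(n+1) t^n]
    ([composition_series_eq]).  As [1 - t f] has constant coefficient 1 it is
    invertible, and [F = f / (1 - t f)]. *)

Set Implicit Arguments.
Unset Strict Implicit.
Unset Printing Implicit Defensive.

Import GRing.Theory.

Local Open Scope ring_scope.

(** The index [i] stands for a first part of size [i.+1], so that its positivity
    is built in and the rest has total size [n.+1 - i.+1 = n - i]. *)
Definition first_part_split (X : nat -> nat) (n : nat) : finType :=
  {i : 'I_n.+1 & ('I_(X i.+1) * colored_composition X (n - i))%type}.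

Lemma cons_composition_subproof (X : nat -> nat) (n : nat)
    (u : first_part_split X n) :
  is_colored_composition n.+1
    (Tagged (fun j => 'I_(X j)) (tagged u).1 :: parts (tagged u).2).
Proof.
case: u => i [c s] /=; case/andP: (valP s) => pos_s /eqP sum_s.
apply/andP; split; first exact: pos_s.
by rewrite big_cons sum_s /part_size /= addSn subnKC // -ltnS.
Qed.

Definition cons_composition {X : nat -> nat} {n : nat}
    (u : first_part_split X n) : colored_composition X n.+1 :=
  ColoredComposition (cons_composition_subproof u).

Lemma cons_composition_inj (X : nat -> nat) (n : nat) :
  injective (@cons_composition X n).
Proof.
move=> [i [c s]] [j [d t]] /(congr1 (@parts X n.+1)) /= [eq_ij].
have {}eq_ij : i = j by apply: val_inj.
case: j / eq_ij d t => d t eq_cd eq_st; congr existT.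
rewrite (val_inj eq_st : s = t); congr pair.
by apply: (eq_from_Tagged (T_ := fun k => 'I_(X k))) eq_cd.
Qed.

Lemma cons_composition_surj (X : nat -> nat) (n : nat)
    (s : colored_composition X n.+1) : s \in codom cons_composition.
Proof.
case: s => [[|[[|i] c] s] comp_s].
(* The empty sequence has sum 0, and a first part of size 0 is excluded. *)
- by case/andP: (comp_s); rewrite big_nil.
- by case/andP: (comp_s).
have /andP[pos_s] := comp_s; rewrite big_cons /part_size /= addSn eqSS.
move=> /eqP sum_s; have lt_in : (i < n.+1)%N by rewrite ltnS -sum_s leq_addr.
have comp_s' : is_colored_composition (n - i) s.
  by apply/andP; split; [exact: pos_s | rewrite -sum_s addKn].
apply/codomP; exists (Tagged (fun k : 'I_n.+1 =>
  ('I_(X k.+1) * colored_composition X (n - k))%type) (i := Ordinal lt_in)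
  (c, ColoredComposition comp_s')).
exact: val_inj.
Qed.

Lemma num_colored_compositions0 (X : nat -> nat) :
  num_colored_compositions X 0 = 1%N.
Proof.
have comp_nil : is_colored_composition 0 (@nil (colored_part X)).
  by rewrite /is_colored_composition big_nil.
apply: (eq_card1 (x := ColoredComposition comp_nil)) => s; rewrite !inE.
apply/esym/eqP/val_inj/eqP; rewrite -size_eq0 -leqn0.
by case: (colored_composition_bounds (valP s)).
Qed.

Lemma num_colored_compositions_rec (X : nat -> nat) (n : nat) :
  num_colored_compositions X n.+1
    = (\sum_(i < n.+1) X i.+1 * num_colored_compositions X (n - i))%N.
Proof.
transitivity #|first_part_split X n|.
  rewrite -(card_codom (@cons_composition_inj X n)).
  by apply: eq_card => s; rewrite cons_composition_surj.
rewrite card_tagged sumnE big_map big_enum.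
by apply: eq_bigr => i _; rewrite card_prod card_ord.
Qed.

Lemma coef_fpsX_mul (R : comNzRingType) (f : fps R) (n : nat) :
  fps_coef (fpsX R * f) n = if n is m.+1 then fps_coef f m else 0.
Proof.
case: n => [|n] /=; first by rewrite big_ord_recl big_ord0 mul0r addr0.
rewrite !big_ord_recl /= mul0r add0r mul1r subn1 big1 ?addr0 // => i _.
by rewrite mul0r.
Qed.

(** A composition is either a single part, counted by [f], or a first part
    followed by a nonempty composition; the exponent being the size minus one,
    such a concatenation gains a factor [t]. *)
Lemma composition_series_eq (X : nat -> nat) :
  let f := Fps (fun n => (X n.+1)%:Z) in
  let F := Fps (fun n => (num_colored_compositions X n.+1)%:Z) in
  F = f + fpsX int * f * F.
Proof.
move=> f F; apply/fpsP => n; rewrite -mulrA.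
transitivity (fps_coef f n + fps_coef (fpsX int * (f * F)) n) => //.
rewrite coef_fpsX_mul /= num_colored_compositions_rec big_ord_recr /=.
(* The last term of the recurrence is the one that uses the empty rest. *)
rewrite subnn num_colored_compositions0 muln1 PoszD addrC; congr (_ + _).
case: n => [|n]; first by rewrite big_ord0.
rewrite -natz natr_sum; apply: eq_bigr => i _.
by rewrite natz PoszM subSn // -ltnS.
Qed.

Theorem mainTheorem1 (X : nat -> nat) :
  let a : nat -> int := fun n => (X n.+1)%:Z in
  (forall n : nat, (1 <= n)%N ->
     (num_colored_compositions X n)%:Z = invert a n.-1)
  /\
  Fps (fun n => (num_colored_compositions X n.+1)%:Z)
    = Fps a / (1 - fpsX int * Fps a).
Proof.
move=> a.
have series_eq : Fps (fun n => (num_colored_compositions X n.+1)%:Z)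
    = Fps a / (1 - fpsX int * Fps a).
  rewrite -[LHS](mulrK (invert_denom_unit (Fps a))); congr (_ / _).
  rewrite mulrC mulrBl mul1r {1}composition_series_eq.
  exact: addrK.
by split=> // -[//|n] _; rewrite /invert -series_eq.
Qed.
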